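(* The theories of the structures $\langle\mathbb{Q}^{\geqslant 0},0,1,\cdot,{}^{-1},R_2,R_3,\ldots\rangle$ and $\langle\mathbb{Q},0,1,-1,\cdot,{}^{-1},R_2,R_3,\ldots,\mathcal{P}\rangle$ admit quantifier elimination.
   Context: $\mathbb{Q}^{\geqslant 0}$ is the set of nonnegative rationals. Constants and multiplication are interpreted as usual; $x^{-1}=1/x$ for $x\neq 0$ and by convention $0^{-1}=0$. For each $n\geq 2$, $R_n$ is the unary predicate ''being the $n$-th power of a rational number'', i.e. $R_n(x)\iff\exists y\,[x=y^n]$. $\mathcal{P}$ is the unary predicate $\mathcal{P}(x)\iff x>0$. *)

(* Defs.v *)
From mathcomp Require Import all_boot all_order all_algebra.

Set Implicit Arguments.
Unset Strict Implicit.
Unset Printing Implicit Defensive.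

Import Order.TTheory GRing.Theory Num.Theory.
Local Open Scope ring_scope.

Record signature := Signature {
  fsym : Type;
  farity : fsym -> nat;
  rsym : Type;
  rarity : rsym -> nat }.

(* Terms and formulas are well-scoped: the free variables of an element of
   [term L n] or [formula L n] are among the n variables of 'I_n.  A quantifier
   binds the variable ord0 of its body and shifts the other ones by one. *)
Inductive term (L : signature) (n : nat) : Type :=
| Var of 'I_n
| App (f : fsym L) of ('I_(farity f) -> term L n).

Inductive formula (L : signature) : nat -> Type :=
| Bot n : formula L n
| Eq n : term L n -> term L n -> formula L n
| Rel n (r : rsym L) : ('I_(rarity r) -> term L n) -> formula L n
| Imp n : formula L n -> formula L n -> formula L n
| And n : formula L n -> formula L n -> formula L n
| Or n : formula L n -> formula L n -> formula L n
| All n : formula L n.+1 -> formula L n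
| Ex n : formula L n.+1 -> formula L n.

Arguments Bot {L n}.

Definition Iff L n (phi psi : formula L n) : formula L n :=
  And (Imp phi psi) (Imp psi phi).

Definition sentence (L : signature) := formula L 0%N.
Definition theory (L : signature) := sentence L -> Prop.

Fixpoint univ_closure L n : formula L n -> sentence L :=
  match n return formula L n -> sentence L with
  | 0%N => fun phi => phi
  | k.+1 => fun phi => univ_closure (All phi)
  end.

Fixpoint quantifier_free L n (phi : formula L n) : Prop :=
  match phi with
  | Bot _ | Eq _ _ _ | Rel _ _ _ => True
  | Imp _ p q | And _ p q | Or _ p q => quantifier_free p /\ quantifier_free q
  | All _ _ | Ex _ _ => False
  end.

Record structure (L : signature) := Structure {
  carrier :> Type;
  carrier_inhabited : inhabited carrier;
  finterp : forall f : fsym L, ('I_(farity f) -> carrier) -> carrier;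
  rinterp : forall r : rsym L, ('I_(rarity r) -> carrier) -> Prop }.

Fixpoint eval L (M : structure L) n (v : 'I_n -> M) (t : term L n) : M :=
  match t with
  | Var i => v i
  | App f ts => finterp (fun i => eval v (ts i))
  end.

Definition extend (T : Type) n (a : T) (v : 'I_n -> T) : 'I_n.+1 -> T :=
  fun i => if unlift ord0 i is Some j then v j else a.

Fixpoint sat L (M : structure L) n (phi : formula L n) : ('I_n -> M) -> Prop :=
  match phi in formula _ n return ('I_n -> M) -> Prop with
  | Bot _ => fun=> False
  | Eq _ s t => fun v => eval v s = eval v t
  | Rel _ r ts => fun v => rinterp (fun i => eval v (ts i))
  | Imp _ p q => fun v => sat p v -> sat q v
  | And _ p q => fun v => sat p v /\ sat q v
  | Or _ p q => fun v => sat p v \/ sat q v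
  | All _ p => fun v => forall a : M, sat p (extend a v)
  | Ex _ p => fun v => exists a : M, sat p (extend a v)
  end.

Definition holds L (M : structure L) (phi : sentence L) : Prop :=
  forall v : 'I_0 -> M, sat phi v.

Definition model L (M : structure L) (T : theory L) : Prop :=
  forall phi, T phi -> holds M phi.

Definition entails L (T : theory L) (phi : sentence L) : Prop :=
  forall M : structure L, model M T -> holds M phi.

Definition Th L (M : structure L) : theory L := fun phi => holds M phi.

Definition admits_QE L (T : theory L) : Prop :=
  forall n (phi : formula L n), exists psi : formula L n,
    quantifier_free psi /\ entails T (univ_closure (Iff phi psi)).

Definition is_nth_power (n : nat) (x : rat) : Prop := exists y : rat, x = y ^+ n.

Inductive nn_fsym := nn_zero | nn_one | nn_mul | nn_inv.

Definition nn_farity (f : nn_fsym) : nat :=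
  match f with nn_zero | nn_one => 0%N | nn_mul => 2%N | nn_inv => 1%N end.

Inductive nn_rsym := nn_R (n : nat) of (2 <= n)%N.

Definition nn_sig : signature :=
  @Signature nn_fsym nn_farity nn_rsym (fun=> 1%N).

Definition nnrat : Type := {x : rat | 0 <= x}.

Definition nnrat_zero : nnrat := exist _ 0 (lexx 0).
Definition nnrat_one : nnrat := exist _ 1 ler01.
Definition nnrat_mul (x y : nnrat) : nnrat :=
  exist _ (sval x * sval y) (mulr_ge0 (svalP x) (svalP y)).

Lemma ratV_ge0 (x : rat) : 0 <= x -> 0 <= x^-1.
Proof. by rewrite invr_ge0. Qed.

(* In MathComp 0^-1 = 0. *)
Definition nnrat_inv (x : nnrat) : nnrat :=
  exist _ (sval x)^-1 (ratV_ge0 (svalP x)).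

Definition nn_finterp (f : nn_fsym) : ('I_(nn_farity f) -> nnrat) -> nnrat :=
  match f return ('I_(nn_farity f) -> nnrat) -> nnrat with
  | nn_zero => fun=> nnrat_zero
  | nn_one => fun=> nnrat_one
  | nn_mul => fun a => nnrat_mul (a ord0) (a ord_max)
  | nn_inv => fun a => nnrat_inv (a ord0)
  end.

Definition nn_rinterp (r : nn_rsym) (a : 'I_1 -> nnrat) : Prop :=
  let: nn_R n _ := r in is_nth_power n (sval (a ord0)).

Definition nnrat_structure : structure nn_sig :=
  @Structure nn_sig nnrat (inhabits nnrat_zero) nn_finterp nn_rinterp.

Inductive q_fsym := q_zero | q_one | q_minus_one | q_mul | q_inv.

Definition q_farity (f : q_fsym) : nat :=
  match f with q_zero | q_one | q_minus_one => 0%N | q_mul => 2%N | q_inv => 1%N end.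

Inductive q_rsym := q_R (n : nat) of (2 <= n)%N | q_P.

Definition q_sig : signature := @Signature q_fsym q_farity q_rsym (fun=> 1%N).

Definition q_finterp (f : q_fsym) : ('I_(q_farity f) -> rat) -> rat :=
  match f return ('I_(q_farity f) -> rat) -> rat with
  | q_zero => fun=> 0
  | q_one => fun=> 1
  | q_minus_one => fun=> -1
  | q_mul => fun a => a ord0 * a ord_max
  | q_inv => fun a => (a ord0)^-1
  end.

Definition q_rinterp (r : q_rsym) (a : 'I_1 -> rat) : Prop :=
  match r with
  | q_R n _ => is_nth_power n (a ord0)
  | q_P => 0 < a ord0
  end.

Definition rat_structure : structure q_sig :=
  @Structure q_sig rat (inhabits 0) q_finterp q_rinterp.

(* Main.v *)
From mathcomp Require Import all_boot all_order all_algebra.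
From mathcomp Require Import boolp zify ring.
Require Import Defs.

Set Implicit Arguments.
Unset Strict Implicit.
Unset Printing Implicit Defensive.

Import Order.TTheory GRing.Theory Num.Theory.
Local Open Scope ring_scope.

(** Quantifier elimination follows from a back-and-forth argument. Two tuples
    of rationals are m-similar when their entries have the same signs and their
    absolute values (0 being replaced by 1) satisfy the same equations
    [x ^ e = 1] with exponents at most m and the same conditions "[x ^ e] is an
    m-th power". Finitely many atomic formulas determine the m-similarity class,
    so it suffices that (2 m m!)-similar tuples x, y can be extended: for every a
    there is b with (a, x) and (b, y) m-similar. If [a ^ k] is a monomial in x
    with small exponents, then b is the k-th root of the same monomial in y.
    Otherwise let d be the order of a modulo x and m-th powers; then
    [a ^ d * x ^ f] is an m-th power for some f, hence [x ^ f], and so also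
    [y ^ f], is a d-th power [h ^ d], and b = p ^ (m / d) / h works for any prime p
    occurring neither in y nor in h. *)

(** * Quantifier-free definability and the back-and-forth criterion *)

Lemma univ_closure_holds L (M : structure L) n (phi : formula L n) :
  (forall v : 'I_n -> M, sat phi v) -> holds M (univ_closure phi).
Proof.
elim: n phi => [|n IHn] phi phiT; first by move=> v; apply: phiT.
by apply: (IHn (All phi)) => v a; apply: phiT.
Qed.

Definition qf_definable L (M : structure L) n (P : ('I_n -> M) -> Prop) :=
  exists2 psi : formula L n, quantifier_free psi & forall v, sat psi v <-> P v.

(** [Th M] contains every sentence true in [M], so an equivalence valid in [M] is entailed outright.
    Only definability in [M] remains to be studied. *)
Lemma admits_QE_definable L (M : structure L) :
  (forall n (phi : formula L n), @qf_definable L M n (fun v => sat phi v)) ->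
  admits_QE (Th M).
Proof.
move=> defM n phi; have [psi qf_psi psiE] := defM n phi.
exists psi; split=> // N; apply.
by apply: univ_closure_holds => v; split=> /psiE.
Qed.

(** Only one implication is required: agreement on the list may be finer than [E]. Hence the notion
    passes to weaker relations and to finite conjunctions, and no formula defining [E] has to be
    written. *)
Definition qf_determined L (M : structure L) n
    (E : ('I_n -> M) -> ('I_n -> M) -> Prop) :=
  exists2 s : seq (formula L n), foldr (fun phi => and (quantifier_free phi)) True s
    & forall v w : 'I_n -> M,
        foldr (fun phi => and (sat phi v <-> sat phi w)) True s -> E v w.

Lemma qf_determined_sub L (M : structure L) n
    (E E' : ('I_n -> M) -> ('I_n -> M) -> Prop) :
  (forall v w, E v w -> E' v w) -> qf_determined E -> qf_determined E'.
Proof. by move=> sEE' [s qf_s sE]; exists s => // v w /sE/sEE'. Qed.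

Lemma qf_determined1 L (M : structure L) n (P : ('I_n -> M) -> Prop) :
  qf_definable P -> qf_determined (fun v w => P v <-> P w).
Proof.
move=> [psi qf_psi psiE]; exists [:: psi] => [//|v w /= [vw _]].
by split=> /psiE/vw/psiE.
Qed.

Lemma qf_determined_and L (M : structure L) n
    (E E' : ('I_n -> M) -> ('I_n -> M) -> Prop) :
  qf_determined E -> qf_determined E' ->
  qf_determined (fun v w => E v w /\ E' v w).
Proof.
move=> [s qf_s sE] [s' qf_s' s'E].
have foldr_cat (Q : formula L n -> Prop) :
    foldr (fun phi => and (Q phi)) True (s ++ s') <->
    foldr (fun phi => and (Q phi)) True s /\ foldr (fun phi => and (Q phi)) True s'.
  by elim: s {qf_s sE} => /= [|phi s IHs]; tauto.
by exists (s ++ s') => [|v w]; rewrite foldr_cat // => -[/sE ? /s'E].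
Qed.

Lemma qf_determined_all L (M : structure L) n (K : finType)
    (E : K -> ('I_n -> M) -> ('I_n -> M) -> Prop) :
  (forall k, qf_determined (E k)) -> qf_determined (fun v w => forall k, E k v w).
Proof.
move=> detE; suff: forall s : seq K, qf_determined (fun v w => {in s, forall k, E k v w}).
  by move/(_ (enum K)); apply: qf_determined_sub => v w Evw k; apply: Evw; rewrite mem_enum.
elim=> [|k s IHs]; first by exists [::].
apply: qf_determined_sub (qf_determined_and (detE k) IHs) => v w [Ek Es] j.
by rewrite inE => /predU1P[->|/Es].
Qed.

(** The truth values of the listed formulas split the tuples into finitely many classes, and [P] is
    a union of classes. The formula is built by branching on one listed formula at a time. *)
Lemma qf_determined_definable L (M : structure L) n
    (E : ('I_n -> M) -> ('I_n -> M) -> Prop) (P : ('I_n -> M) -> Prop) :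
  qf_determined E -> (forall v w, E v w -> P v -> P w) -> qf_definable P.
Proof.
move=> [s qf_s sE] EP.
have {E sE EP}: forall v w : 'I_n -> M,
    foldr (fun phi => and (sat phi v <-> sat phi w)) True s -> P v -> P w.
  by move=> v w /sE; apply: EP.
elim: s qf_s P => /= [_|phi s IHs [qf_phi qf_s]] P Pinv.
  (* For the empty list all tuples agree, so [P] is constant. *)
  have [[v Pv]|noP] := pselect (exists v, P v).
    by exists (Imp Bot Bot) => // w /=; split=> // _; apply: Pinv Pv.
  by exists Bot => // w /=; split=> // Pw; apply: noP; exists w.
pose agree (v w : 'I_n -> M) := foldr (fun phi => and (sat phi v <-> sat phi w)) True s.
have agree_refl (v : 'I_n -> M) : agree v v by rewrite /agree; elim: (s) => /=; tauto.
have agree_trans (u v w : 'I_n -> M) : agree u v -> agree v w -> agree u w.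
  by rewrite /agree; elim: (s) => //= psi r; tauto.
(* The induction hypothesis is applied to the saturation, under agreement on the tail [s], of the
   part of [P] where [phi] holds, and then of the part where it fails. *)
have [psi1 qf1 psi1E] := IHs qf_s
  (fun v => exists2 w, sat phi w /\ P w & agree w v)
  (fun v w vw '(ex_intro2 u Pu uv) => ex_intro2 _ _ u Pu (agree_trans u v w uv vw)).
have [psi0 qf0 psi0E] := IHs qf_s
  (fun v => exists2 w, ~ sat phi w /\ P w & agree w v)
  (fun v w vw '(ex_intro2 u Pu uv) => ex_intro2 _ _ u Pu (agree_trans u v w uv vw)).
exists (Or (And phi psi1) (And (Imp phi Bot) psi0)) => [//|v /=].
rewrite psi1E psi0E; split=> [[] [phiv [w [phiw Pw] wv]]|Pv].
- by apply: Pinv Pw; split.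
- by apply: Pinv Pw; split.
- by have [phiv|phiv] := pselect (sat phi v); [left|right]; split=> //; exists v.
Qed.

(* An Ehrenfeucht-Fraisse criterion: the levels m > 0 are ordered by
   divisibility, [sim m] being finer for larger m. *)
Lemma back_and_forth_QE L (M : structure L)
    (sim : nat -> forall n, ('I_n -> M) -> ('I_n -> M) -> Prop) :
  (forall m n (v w : 'I_n -> M), sim m n v w -> sim m n w v) ->
  (forall m k n (v w : 'I_n -> M), (0 < m)%N -> (0 < k)%N ->
     sim (m * k)%N n v w -> sim m n v w) ->
  (forall m n, (0 < m)%N -> qf_determined (@sim m n)) ->
  (forall n (s t : term L n), exists2 m, (0 < m)%N & forall v w : 'I_n -> M,
     sim m n v w -> eval v s = eval v t -> eval w s = eval w t) ->
  (forall n (r : rsym L) (ts : 'I_(rarity r) -> term L n),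
     exists2 m, (0 < m)%N & forall v w : 'I_n -> M, sim m n v w ->
     rinterp (fun i => eval v (ts i)) -> rinterp (fun i => eval w (ts i))) ->
  (forall m n, (0 < m)%N -> exists2 k, (0 < k)%N & forall v w : 'I_n -> M,
     sim k n v w -> forall a, exists b, sim m n.+1 (extend a v) (extend b w)) ->
  admits_QE (Th M).
Proof.
move=> simC simM sim_det simEq simR sim_ext; apply: admits_QE_definable => n phi.
suff [m m_gt0 phi_inv]: exists2 m, (0 < m)%N &
    forall v w : 'I_n -> M, sim m n v w -> (sat phi v <-> sat phi w).
  by apply: qf_determined_definable (sim_det m n m_gt0) _ => v w /phi_inv[].
have simMl m k n' (v w : 'I_n' -> M) : (0 < m)%N -> (0 < k)%N ->
    sim (m * k)%N n' v w -> sim k n' v w by rewrite mulnC => *; apply: (simM k m).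
elim: phi => {n} [n|n s t|n r ts|n p [m m0 IHp] q [k k0 IHq]|n p [m m0 IHp] q [k k0 IHq]
  |n p [m m0 IHp] q [k k0 IHq]|n p [m m0 IHp]|n p [m m0 IHp]] /=.
- by exists 1%N.
- by have [m m0 mP] := simEq n s t; exists m => // v w vw; split; apply: mP; last apply: simC.
- by have [m m0 mP] := simR n r ts; exists m => // v w vw; split; apply: mP; last apply: simC.
- exists (m * k)%N => [|v w vw]; first by rewrite muln_gt0 m0.
  by have := IHp v w (simM _ _ _ _ _ m0 k0 vw); have := IHq v w (simMl _ _ _ _ _ m0 k0 vw); tauto.
- exists (m * k)%N => [|v w vw]; first by rewrite muln_gt0 m0.
  by have := IHp v w (simM _ _ _ _ _ m0 k0 vw); have := IHq v w (simMl _ _ _ _ _ m0 k0 vw); tauto.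
- exists (m * k)%N => [|v w vw]; first by rewrite muln_gt0 m0.
  by have := IHp v w (simM _ _ _ _ _ m0 k0 vw); have := IHq v w (simMl _ _ _ _ _ m0 k0 vw); tauto.
- have [k k0 kP] := sim_ext m n m0; exists k => // v w vw; split=> pT a.
    by have [b /IHp ab] := kP _ _ (simC _ _ _ _ vw) a; apply/ab/pT.
  by have [b /IHp ab] := kP _ _ vw a; apply/ab/pT.
- have [k k0 kP] := sim_ext m n m0; exists k => // v w vw; split=> -[a pa].
    by have [b /IHp ab] := kP _ _ vw a; exists b; apply/ab.
  by have [b /IHp ab] := kP _ _ (simC _ _ _ _ vw) a; exists b; apply/ab.
Qed.

(** * Valuations of rationals at a prime *)

Definition padic_val (p : nat) (x : rat) : int :=
  (logn p `|numq x|)%:Z - (logn p `|denq x|)%:Z.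

Lemma padic_valM p (x y : rat) : x != 0 -> y != 0 ->
  padic_val p (x * y) = padic_val p x + padic_val p y.
Proof.
move=> x0 y0; have xy0 : x * y != 0 by rewrite mulf_neq0.
(* Cross-multiplying avoids computing the common factors that cancel in the reduced fraction of
   [x * y]. *)
have: (numq (x * y) * (denq x * denq y))%:~R = (numq x * numq y * denq (x * y))%:~R :> rat.
  by rewrite !intrM !numqE; ring.
move/intr_inj/(congr1 absz)/(congr1 (logn p)); rewrite !abszM.
by rewrite !lognM ?muln_gt0 ?absz_gt0 ?numq_eq0 ?denq_eq0 // /padic_val; lia.
Qed.

Lemma padic_val1 p : padic_val p 1 = 0.
Proof. by rewrite /padic_val !logn1. Qed.

Lemma padic_valX p (x : rat) n : x != 0 -> padic_val p (x ^+ n) = n%:Z * padic_val p x.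
Proof.
move=> x0; elim: n => [|n IHn]; first by rewrite expr0 padic_val1 mul0r.
by rewrite exprS padic_valM ?expf_neq0 // IHn; lia.
Qed.

Lemma padic_valV p (x : rat) : x != 0 -> padic_val p x^-1 = - padic_val p x.
Proof.
move=> x0; have := padic_valM p x0 (invr_neq0 x0).
by rewrite divff // padic_val1; lia.
Qed.

Lemma padic_valXz p (x : rat) (z : int) : x != 0 -> padic_val p (x ^ z) = z * padic_val p x.
Proof.
move=> x0; case: z => n; first by rewrite -exprnP padic_valX.
by rewrite NegzE -exprnN padic_valV ?expf_neq0 // padic_valX //; lia.
Qed.

Lemma padic_val_prime p : prime p -> padic_val p p%:Q = 1.
Proof. by move=> p_pr; rewrite /padic_val numq_int denq_int /= logn_prime // eqxx logn1. Qed.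

(** A prime exceeding the sum of all [|numq x|] and [|denq x|] divides none of these numbers that is
    nonzero, and [logn p 0] is 0. *)
Lemma fresh_prime (s : seq rat) : exists2 p, prime p & {in s, forall x, padic_val p x = 0}.
Proof.
have logn_small p n : (n < p)%N -> logn p n = 0%N.
  move=> lt_np; case: (posnP n) => [->|n_gt0]; first by rewrite logn0.
  by rewrite lognE; case: ifP => // /and3P[_ _ /dvdn_leq-/(_ n_gt0)]; rewrite leqNgt lt_np.
have [p p_gt p_pr] := prime_above (\sum_(x <- s) (`|numq x| + `|denq x|)).
exists p => // x xs; move: p_gt; rewrite (big_rem x) //= => p_gt.
by rewrite /padic_val !logn_small //; lia.
Qed.

(** * Monomials with integer exponents *)

Definition monomial n (x : 'I_n -> rat) (e : 'I_n -> int) : rat := \prod_i x i ^ e i.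

Lemma monomial_gt0 n (x : 'I_n -> rat) e : (forall i, 0 < x i) -> 0 < monomial x e.
Proof. by move=> x_gt0; apply: prodr_gt0 => i _; apply: exprz_gt0. Qed.

Lemma monomial0 n (x : 'I_n -> rat) : monomial x (fun=> 0) = 1.
Proof. by apply: big1 => i _; rewrite expr0z. Qed.

Lemma monomialD n (x : 'I_n -> rat) e f : (forall i, 0 < x i) ->
  monomial x (fun i => e i + f i) = monomial x e * monomial x f.
Proof.
move=> x_gt0; rewrite /monomial -big_split; apply: eq_bigr => i _ /=.
by rewrite expfzDr // gt_eqF.
Qed.

Lemma monomialZ n (x : 'I_n -> rat) e (c : int) :
  monomial x (fun i => c * e i) = monomial x e ^ c.
Proof.
rewrite /monomial (big_morph (fun y : rat => y ^ c) (id1 := 1) (op1 := *%R)).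
- by apply: eq_bigr => i _; rewrite exprz_exp mulrC.
- by move=> y z; apply: expfzMl.
- by rewrite exp1rz.
Qed.

Lemma padic_val_monomial p n (x : 'I_n -> rat) e : (forall i, 0 < x i) ->
  (forall i, padic_val p (x i) = 0) -> padic_val p (monomial x e) = 0.
Proof.
move=> x_gt0 xp.
suff [_ //]: monomial x e != 0 /\ padic_val p (monomial x e) = 0.
rewrite /monomial; elim/big_ind: _ => [|y z [y0 yp] [z0 zp]|i _].
- by rewrite oner_neq0 padic_val1.
- by rewrite mulf_neq0 // padic_valM // yp zp.
- by rewrite gt_eqF ?exprz_gt0 // padic_valXz ?gt_eqF // xp mulr0.
Qed.

(** * Perfect powers and similarity of positive tuples *)

Lemma nth_power_pos m (x : rat) : (0 < m)%N -> 0 < x -> is_nth_power m x ->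
  exists2 y, 0 < y & x = y ^+ m.
Proof.
move=> m_gt0 x_gt0 [y xE]; have y0 : y != 0.
  by apply: contraTneq x_gt0 => y0; rewrite xE y0 expr0n gtn_eqF // ltxx.
exists `|y|; first by rewrite normr_gt0.
by rewrite -normrX -xE gtr0_norm.
Qed.

(** Positive k-th roots are unique. This trades a power condition for one of higher index, at the
    cost of multiplying the exponents of a monomial by k. *)
Lemma nth_powerM_pow m k (x : rat) : (0 < m)%N -> (0 < k)%N -> 0 < x ->
  is_nth_power (m * k) (x ^+ k) <-> is_nth_power m x.
Proof.
move=> m_gt0 k_gt0 x_gt0; split=> [|[y ->]]; last by exists y; rewrite exprM.
move=> /nth_power_pos[||y y_gt0]; rewrite ?muln_gt0 ?m_gt0 ?exprn_gt0 // exprM.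
move/eqP; rewrite eqrXn2 ?exprn_ge0 ?ltW // => /eqP ->.
by exists y.
Qed.

Lemma nth_powerMr m (x y : rat) : y != 0 -> is_nth_power m y ->
  is_nth_power m (x * y) <-> is_nth_power m x.
Proof.
move=> y0 [z yE]; split=> [[t xyE]|[t ->]]; last by exists (t * z); rewrite exprMn yE.
by exists (t / z); rewrite exprMn exprVn -yE -xyE mulfK.
Qed.

Lemma nth_powerXz m (x : rat) z : is_nth_power m x -> is_nth_power m (x ^ z).
Proof. by move=> [y ->]; exists (y ^ z); rewrite !exprnP !exprz_exp mulrC. Qed.

(** Equations need bounded exponents to be finite in number. Power conditions do not: they depend
    only on the exponents modulo m. *)
Definition monomial_sim (m n : nat) (x y : 'I_n -> rat) : Prop :=
  (forall e : 'I_n -> int, (forall i, `|e i|%N <= m)%N ->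
     monomial x e = 1 <-> monomial y e = 1) /\
  (forall e, is_nth_power m (monomial x e) <-> is_nth_power m (monomial y e)).

Lemma monomial_simC m n (x y : 'I_n -> rat) : monomial_sim m x y -> monomial_sim m y x.
Proof. by move=> [simE simR]; split=> e *; [rewrite simE | rewrite simR]. Qed.

(** If m = k d, a positive rational is a d-th power exactly when its k-th power is an m-th power,
    and the k-th power of a monomial is a monomial. *)
Lemma monomial_sim_nth_power m d n (x y : 'I_n -> rat) e :
  (forall i, 0 < x i) -> (forall i, 0 < y i) -> (0 < m)%N -> (d %| m)%N ->
  monomial_sim m x y ->
  is_nth_power d (monomial x e) -> is_nth_power d (monomial y e).
Proof.
move=> x0 y0 m0 /dvdnP[k mE] [_ simR]; move: m0; rewrite mE muln_gt0 => /andP[k0 d0].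
rewrite -(nth_powerM_pow d0 k0) ?monomial_gt0 // => xe.
rewrite -(nth_powerM_pow d0 k0) ?monomial_gt0 //.
by move: xe; rewrite !exprnP -!monomialZ mulnC -mE => /simR.
Qed.

Lemma monomial_simM m k n (x y : 'I_n -> rat) :
  (forall i, 0 < x i) -> (forall i, 0 < y i) -> (0 < m)%N -> (0 < k)%N ->
  monomial_sim (m * k) x y -> monomial_sim m x y.
Proof.
move=> x0 y0 m0 k0 sim_xy; have mk0 : (0 < m * k)%N by rewrite muln_gt0 m0.
split=> e.
  move=> le_em; apply: sim_xy.1 => i.
  by apply: leq_trans (le_em i) _; rewrite leq_pmulr.
by split; apply: monomial_sim_nth_power mk0 (dvdn_mulr _ (dvdnn m)) _ => //; apply: monomial_simC.
Qed.

Lemma extend0 T n a (v : 'I_n -> T) : extend a v ord0 = a.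
Proof. by rewrite /extend unlift_none. Qed.

Lemma extendS T n a (v : 'I_n -> T) i : extend a v (lift ord0 i) = v i.
Proof. by rewrite /extend liftK. Qed.

Lemma monomial_extend n a (x : 'I_n -> rat) e :
  monomial (extend a x) e = a ^ e ord0 * monomial x (fun i => e (lift ord0 i)).
Proof.
rewrite /monomial big_ord_recl extend0; congr (_ * _).
by apply: eq_bigr => i _; rewrite extendS.
Qed.

(* An element [a] algebraic over [x] is matched with the k-th root of the
   corresponding monomial in [y]. *)
Lemma monomial_sim_extend_alg m n (x y : 'I_n -> rat) a k e :
  (forall i, 0 < x i) -> (forall i, 0 < y i) -> 0 < a ->
  (0 < k <= m)%N -> (forall i, `|e i| <= m)%N -> a ^+ k = monomial x e ->
  monomial_sim (2 * m * m`!) x y ->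
  exists2 b, 0 < b & monomial_sim m (extend a x) (extend b y).
Proof.
move=> x0 y0 a0 /andP[k0 le_km] le_em aE sim_xy.
have m0 : (0 < m)%N := leq_trans k0 le_km.
have M0 : (0 < 2 * m * m`!)%N by rewrite !muln_gt0 m0 fact_gt0.
have dvd_km : (k %| m`!)%N by rewrite dvdn_fact // k0.
(* The monomial in x is the k-th power of [a]; this transfers to y because k divides m!. *)
have [b b0 bE]: exists2 b, 0 < b & monomial y e = b ^+ k.
  apply: nth_power_pos; rewrite ?monomial_gt0 //.
  apply: monomial_sim_nth_power (dvdn_mull _ dvd_km) sim_xy _ => //.
  by exists a.
(* Taking k-th powers eliminates the new variable. *)
have powk (z : 'I_n -> rat) c f : (forall i, 0 < z i) -> 0 < c -> c ^+ k = monomial z e ->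
    (monomial (extend c z) f) ^+ k =
    monomial z (fun i => f ord0 * e i + k%:Z * f (lift ord0 i)).
  move=> z0 c0 cE; rewrite monomial_extend exprMn monomialD // !monomialZ -cE.
  by rewrite !exprnP !exprz_exp mulrC [in RHS]mulrC (mulrC (f ord0)).
have mon0 (z : 'I_n -> rat) c f : (forall i, 0 < z i) -> 0 < c -> 0 < monomial (extend c z) f.
  by move=> *; rewrite monomial_extend mulr_gt0 ?monomial_gt0 ?exprz_gt0.
exists b => //; split=> f.
  move=> le_fm.
  have eq1k (t : rat) : 0 < t -> t = 1 <-> t ^+ k = 1.
    move=> t0; split=> [->|/eqP]; first by rewrite expr1n.
    by rewrite pexpr_eq1 ?ltW // => /eqP.
  rewrite eq1k ?mon0 // [_ (extend b y) _ = _]eq1k ?mon0 // !powk //.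
  apply: sim_xy.1 => i.
  have fact_m : (m <= m`!)%N by rewrite dvdn_leq ?fact_gt0 // dvdn_fact // m0 leqnn.
  (* Both summands of the exponent are at most m * m in absolute value, and 2 * m * m is below the
     given level since m is at most m!. *)
  apply: (@leq_trans (m * m + m * m)%N); last by nia.
  apply: (@leq_trans (`|(f ord0 * e i)%R| + `|(k%:Z * f (lift ord0 i))%R|)%N); first by lia.
  by rewrite !abszM; apply: leq_add; apply: leq_mul.
rewrite -(nth_powerM_pow m0 k0) ?mon0 //.
rewrite -(nth_powerM_pow (x := monomial (extend b y) f) m0 k0) ?mon0 //.
rewrite !powk //.
have dvd_mk : (m * k %| 2 * m * m`!)%N by rewrite dvdn_mul // dvdn_mull.
by split; apply: monomial_sim_nth_power dvd_mk _ => //; apply: monomial_simC.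
Qed.

(* [d] is the order of [a] modulo [x] and m-th powers; a d-th root of the
   monomial in [y] matching [a ^+ d] is made independent of [y] by a fresh prime
   raised to the power m / d. *)
Lemma monomial_sim_extend_transc m n (x y : 'I_n -> rat) a :
  (forall i, 0 < x i) -> (forall i, 0 < y i) -> 0 < a -> (0 < m)%N ->
  (forall (k : int) e, (`|k| <= m)%N -> (forall i, `|e i| <= m)%N ->
     a ^ k * monomial x e = 1 -> k = 0) ->
  monomial_sim m x y ->
  exists2 b, 0 < b & monomial_sim m (extend a x) (extend b y).
Proof.
move=> x0 y0 a0 m0 a_free sim_xy.
pose good d := `[< (0 < d)%N /\ exists f, is_nth_power m (a ^ d%:Z * monomial x f) >].
have good_m : exists d, good d.
  exists m; apply/asboolP; split=> //; exists (fun=> 0).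
  by rewrite monomial0 mulr1; exists a.
case: (ex_minnP good_m) => d /asboolP[d0 [f0 adf0]] d_min {good_m}.
have mon_split (z : 'I_n -> rat) b c f : (forall i, 0 < z i) -> 0 < b ->
    b ^ (c * d%:Z) * monomial z f = monomial z (fun i => f i - c * f0 i) *
      (b ^ d%:Z * monomial z f0) ^ c.
  move=> z0 b0; rewrite expfzMl exprz_exp (mulrC d%:Z) -monomialZ mulrCA -monomialD //.
  by congr (_ * _); apply: eq_bigr => i _; rewrite subrK.
have nth_split (z : 'I_n -> rat) b c f : (forall i, 0 < z i) -> 0 < b ->
    is_nth_power m (b ^ d%:Z * monomial z f0) ->
    is_nth_power m (b ^ (c * d%:Z) * monomial z f) <->
    is_nth_power m (monomial z (fun i => f i - c * f0 i)).
  move=> z0 b0 bdf0; rewrite mon_split // nth_powerMr //; last exact: nth_powerXz.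
  by rewrite gt_eqF ?exprz_gt0 ?mulr_gt0 ?exprz_gt0 ?monomial_gt0.
(* Otherwise the remainder of j modulo d would contradict the minimality of d. *)
have d_dvd j f : is_nth_power m (a ^ j * monomial x f) -> (j %% d%:Z)%Z = 0.
  move=> ajf; have r0 : 0 <= (j %% d%:Z)%Z by rewrite modz_ge0; lia.
  have ltrd : (j %% d%:Z)%Z < d%:Z by rewrite ltz_pmod; lia.
  case: (eqVneq (j %% d%:Z)%Z 0) => // rn0.
  suff /d_min: good `|(j %% d%:Z)%Z|%N by lia.
  apply/asboolP; split; first by lia.
  exists (fun i => f i - (j %/ d%:Z)%Z * f0 i); rewrite gez0_abs //.
  move: ajf; rewrite {1}(divz_eq j d%:Z) expfzDr ?gt_eqF // mulrAC mon_split // mulrAC.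
  rewrite nth_powerMr; first by rewrite mulrC.
    by rewrite gt_eqF ?exprz_gt0 ?mulr_gt0 ?exprz_gt0 ?monomial_gt0.
  exact: nth_powerXz.
have [q mE]: exists q, m = (q * d)%N.
  apply/dvdnP; rewrite /dvdn; have := @d_dvd m%:Z (fun=> 0).
  by rewrite monomial0 mulr1 modz_nat => /(_ (ex_intro _ a erefl)); lia.
have q0 : (0 < q)%N by move: m0; rewrite mE muln_gt0 => /andP[].
(* From [a ^ d * x ^ f0 = g ^ m] and m = q d, the monomial [x ^ f0] is the d-th power of
   [g ^ q / a]; this transfers to y since d divides m. *)
have [h h0 hE]: exists2 h, 0 < h & monomial y f0 = h ^+ d.
  apply: nth_power_pos; rewrite ?monomial_gt0 //.
  apply: monomial_sim_nth_power sim_xy _ => //; first by rewrite mE dvdn_mull.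
  have [g gE] := adf0; exists (g ^+ q / a).
  by rewrite exprMn -exprM -mE -gE exprVn -exprnP mulrAC divff ?mul1r // expf_neq0 ?gt_eqF.
have [p p_pr p_fresh] := fresh_prime (h :: [seq y i | i <- enum 'I_n]).
have hp : padic_val p h = 0 by apply: p_fresh; rewrite mem_head.
have yp i : padic_val p (y i) = 0.
  by apply: p_fresh; rewrite inE map_f ?orbT // mem_enum.
have p0 : 0 < p%:Q by rewrite ltr0z; have := prime_gt0 p_pr; lia.
(* With this choice [b ^ d * y ^ f0 = p ^ m], while [b] has valuation q at p and all entries of y
   have valuation 0. *)
pose b := p%:Q ^+ q / h.
have b0 : 0 < b by rewrite divr_gt0 ?exprn_gt0.
have bp : padic_val p b = q.
  rewrite padic_valM ?expf_neq0 ?invr_neq0 ?gt_eqF // padic_valX ?gt_eqF //.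
  by rewrite padic_valV ?gt_eqF // hp padic_val_prime //; lia.
have bjp j f : padic_val p (b ^ j * monomial y f) = j * q%:Z.
  rewrite padic_valM ?gt_eqF ?exprz_gt0 ?monomial_gt0 //.
  by rewrite padic_valXz ?gt_eqF // bp padic_val_monomial // addr0.
have bdf0 : is_nth_power m (b ^ d%:Z * monomial y f0).
  exists p%:Q; rewrite hE -exprnP -exprMn /b divfK ?gt_eqF //.
  by rewrite -exprM -mE.
exists b => //; split=> e.
  (* In either direction the new exponent is 0: for [a] by [a_free], for [b] by comparing valuations
     at p. *)
  move=> le_em; rewrite !monomial_extend; split=> eq1.
    have e0 := a_free _ _ (le_em _) (fun i => le_em _) eq1.
    move: eq1; rewrite e0 !expr0z !mul1r => /sim_xy.1; apply.
    by move=> i; apply: le_em.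
  have e0 : e ord0 = 0.
    by have := bjp (e ord0) (fun i => e (lift ord0 i)); rewrite eq1 padic_val1; nia.
  move: eq1; rewrite e0 !expr0z !mul1r => /sim_xy.1; apply.
  by move=> i; apply: le_em.
rewrite !monomial_extend; set f := fun i => _.
(* If d divides the new exponent, a power of the m-th power formed with [f0] splits off, leaving
   monomials in x and y alone. *)
have [/eqP|dj] := eqVneq (e ord0 %% d%:Z)%Z 0.
  rewrite -/(_ %| _)%Z => /eqP; rewrite {2 3}(divz_eq (e ord0) d%:Z) => ->; rewrite addr0.
  by rewrite !nth_split //; apply: sim_xy.2.
(* Otherwise neither side is an m-th power: on the side of [b] the valuation, q times the new
   exponent, would be a multiple of q d. *)
split=> [/d_dvd dj0|[z zE]]; first by rewrite dj0 eqxx in dj.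
have z0 : z != 0.
  have: 0 < z ^+ m by rewrite -zE mulr_gt0 ?exprz_gt0 ?monomial_gt0.
  by apply: contraTneq => ->; rewrite expr0n gtn_eqF // ltxx.
have := bjp (e ord0) f; rewrite zE padic_valX // mE => ejq.
have ejd : e ord0 = padic_val p z * d%:Z.
  by apply: (mulIf (x := q%:Z)); [lia | rewrite -ejq; lia].
by rewrite ejd modzMl eqxx in dj.
Qed.

Lemma monomial_sim_extend m n (x y : 'I_n -> rat) a :
  (forall i, 0 < x i) -> (forall i, 0 < y i) -> 0 < a -> (0 < m)%N ->
  monomial_sim (2 * m * m`!) x y ->
  exists2 b, 0 < b & monomial_sim m (extend a x) (extend b y).
Proof.
move=> x0 y0 a0 m0 sim_xy.
have [[k [e [k0 le_ke aE]]]|a_free] := pselect (exists k e,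
    [/\ (0 < k <= m)%N, forall i, (`|e i| <= m)%N & a ^+ k = monomial x e]).
  exact: monomial_sim_extend_alg aE sim_xy.
apply: monomial_sim_extend_transc => //; last first.
  by apply: (@monomial_simM m (2 * m`!)); rewrite ?muln_gt0 ?fact_gt0 // mulnCA mulnA.
move=> k e le_km le_em aE; apply/eqP/negPn/negP => k0; apply: a_free.
have aE' : a ^ k = monomial x e ^ (-1).
  by rewrite exprN1; apply: (mulIf (x := monomial x e)); rewrite ?mulVf // gt_eqF ?monomial_gt0.
(* The sign of k decides whether [a ^ |k|] equals the inverse monomial or the monomial itself. *)
case: (leP 0 k) => k_ge0.
  exists `|k|%N, (fun i => -1 * e i); split=> [|i|]; [lia | by rewrite mulN1r abszN |].
  by rewrite monomialZ -aE' exprnP gez0_abs.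
exists `|k|%N, e; split=> //; first lia.
rewrite exprnP ltz0_abs // -invr_expz aE' exprN1.
by rewrite invrK.
Qed.

(** * Tuples with signs and zeros *)

Definition abs1 (x : rat) : rat := if x == 0 then 1 else `|x|.

Lemma abs1_gt0 x : 0 < abs1 x.
Proof. by rewrite /abs1; case: eqVneq => // x0; rewrite normr_gt0. Qed.

Lemma abs1E x : x != 0 -> abs1 x = `|x|.
Proof. by rewrite /abs1 => /negPf->. Qed.

Lemma comp_extend S T (f : S -> T) n a (v : 'I_n -> S) :
  f \o extend a v = extend (f a) (f \o v).
Proof. by apply: funext => i; rewrite /= /extend; case: unlift. Qed.

Lemma monomial_delta n (x : 'I_n -> rat) i : monomial x (fun j => (j == i)%:Z) = x i.
Proof.
rewrite /monomial (bigD1 i) //= eqxx expr1z big1 ?mulr1 // => j /negPf->.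
by rewrite expr0z.
Qed.

(** Since [abs1] is positive everywhere, the results on positive tuples apply; the signs tell apart
    the entries 0 and 1, which [abs1] identifies. *)
Definition rat_sim (m n : nat) (v w : 'I_n -> rat) : Prop :=
  (forall i, Num.sg (v i) = Num.sg (w i)) /\ monomial_sim m (abs1 \o v) (abs1 \o w).

Lemma rat_simC m n (v w : 'I_n -> rat) : rat_sim m v w -> rat_sim m w v.
Proof. by move=> [sgE /monomial_simC sim_wv]; split. Qed.

Lemma rat_simM m k n (v w : 'I_n -> rat) :
  (0 < m)%N -> (0 < k)%N -> rat_sim (m * k) v w -> rat_sim m v w.
Proof.
move=> m0 k0 [sgE sim_vw]; split=> //.
by apply: monomial_simM sim_vw => // i; apply: abs1_gt0.
Qed.

(** The match of [abs1 a] receives the sign of [a]. The separate sign equation later keeps the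
    witness nonnegative over the nonnegative rationals. *)
Lemma rat_sim_extend m n (v w : 'I_n -> rat) a :
  (0 < m)%N -> rat_sim (2 * m * m`!) v w ->
  exists2 b, Num.sg b = Num.sg a & rat_sim m (extend a v) (extend b w).
Proof.
move=> m0 [sgE sim_vw].
have [||c c0 sim_ac] := monomial_sim_extend _ _ (abs1_gt0 a) m0 sim_vw.
- by move=> i; apply: abs1_gt0.
- by move=> i; apply: abs1_gt0.
have sgc : Num.sg (Num.sg a * c) = Num.sg a by rewrite sgr_smul (gtr0_sg c0) mulr1.
exists (Num.sg a * c) => //; split.
  by move=> i; rewrite /extend; case: unlift.
rewrite !comp_extend; suff -> : abs1 (Num.sg a * c) = c by [].
have [a0|a0] := eqVneq a 0; last first.
  by rewrite abs1E ?normrM ?normr_sg ?a0 ?mul1r ?gtr0_norm // mulf_neq0 ?sgr_eq0 // gt_eqF.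
(* If [a] is 0, then [abs1 a] is 1, and the equation given by the first coordinate forces c = 1, the
   value of [abs1] at 0. *)
have := sim_ac.1 (fun j => (j == ord0)%:Z); rewrite !monomial_delta !extend0.
rewrite {1}/abs1 a0 eqxx => -[|c1 _]; first by move=> i; case: eqP.
by rewrite c1 // sgr0 mul0r /abs1 eqxx.
Qed.

(* Squaring removes the signs; exponents of vanishing variables are set to 0
   before comparing with the monomials of [abs1]. *)
Lemma rat_sim_squares m n (v w : 'I_n -> rat) : (0 < m)%N ->
  (forall i, Num.sg (v i) = Num.sg (w i)) ->
  (forall e, (forall i, `|e i| <= m)%N ->
     monomial v e ^+ 2 = 1 <-> monomial w e ^+ 2 = 1) ->
  (forall e, (forall i, `|e i| <= m)%N ->
     is_nth_power (m * 2) (monomial v e ^+ 2) <-> is_nth_power (m * 2) (monomial w e ^+ 2)) ->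
  rat_sim m v w.
Proof.
move=> m0 sgE sim1 simR; split=> //.
pose mask (e : 'I_n -> int) i := if v i == 0 then 0 else e i.
have maskE (u : 'I_n -> rat) e : (forall i, (u i == 0) = (v i == 0)) ->
    monomial (abs1 \o u) e = `|monomial u (mask e)|.
  move=> u0; rewrite /monomial normr_prod; apply: eq_bigr => i _ /=.
  rewrite /mask -u0 /abs1; case: eqVneq => [->|ui0]; first by rewrite exp1rz expr0z normr1.
  by case: (e i) => k; rewrite ?NegzE -?exprnN -?exprnP ?normfV normrX.
have w0 i : (w i == 0) = (v i == 0) by rewrite -[LHS]sgr_eq0 -sgE sgr_eq0.
have le_mask e : (forall i, `|e i| <= m)%N -> (forall i, `|mask e i| <= m)%N.
  by move=> le_em i; rewrite /mask; case: ifP.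
have abs_gt0 (u : 'I_n -> rat) : forall i, 0 < (abs1 \o u) i by move=> i; apply: abs1_gt0.
split=> e.
  move=> le_em; have sqr1 (x : rat) : `|x| = 1 <-> x ^+ 2 = 1.
    rewrite -real_normK ?num_real //; split=> [->|/eqP]; first by rewrite expr1n.
    by rewrite pexpr_eq1 // => /eqP.
  by rewrite !maskE // !sqr1; apply: sim1 (le_mask _ le_em).
(* Reducing exponents modulo m brings them within the bound of the hypothesis. *)
have red (u : 'I_n -> rat) : is_nth_power m (monomial (abs1 \o u) e) <->
    is_nth_power m (monomial (abs1 \o u) (fun i => (e i %% m%:Z)%Z)).
  have -> : monomial (abs1 \o u) e = monomial (abs1 \o u) (fun i => (e i %% m%:Z)%Z) *
      monomial (abs1 \o u) (fun i => m%:Z * (e i %/ m%:Z)%Z).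
    rewrite -monomialD //; apply: eq_bigr => i _.
    by rewrite {1}(divz_eq (e i) m%:Z) mulrC addrC [m%:Z * _]mulrC.
  rewrite nth_powerMr //; first by rewrite gt_eqF ?monomial_gt0.
  by rewrite monomialZ; exists (monomial (abs1 \o u) (fun i => (e i %/ m%:Z)%Z)).
rewrite red (red w); set f := fun i => _.
have le_fm i : (`|f i| <= m)%N.
  have : 0 <= f i by rewrite modz_ge0; lia.
  by have : f i < m%:Z by [rewrite ltz_pmod; lia]; lia.
have sqrR (u : 'I_n -> rat) : (forall i, (u i == 0) = (v i == 0)) ->
    is_nth_power m (monomial (abs1 \o u) f) <->
    is_nth_power (m * 2) (monomial u (mask f) ^+ 2).
  move=> u0; rewrite -(nth_powerM_pow (k := 2)) ?monomial_gt0 // maskE //.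
  by rewrite real_normK ?num_real.
by rewrite !sqrR //; apply: simR (le_mask _ le_fm).
Qed.

(** * Similarity in terms of atomic formulas *)

Lemma rat_sim_determined L (M : structure L) (val : M -> rat) m n : (0 < m)%N ->
  (forall i : 'I_n, @qf_determined L M n (fun v w => Num.sg (val (v i)) = Num.sg (val (w i)))) ->
  (forall e, @qf_definable L M n (fun v => monomial (val \o v) e ^+ 2 = 1)) ->
  (forall e, @qf_definable L M n
     (fun v => is_nth_power (m * 2) (monomial (val \o v) e ^+ 2))) ->
  @qf_determined L M n (fun v w => rat_sim m (val \o v) (val \o w)).
Proof.
move=> m0 det_sg def1 defR.
(* Exponents between -m and m are shifted by m, so that they range over a finite type. *)
pose expo (k : {ffun 'I_n -> 'I_(m + m).+1}) i : int := (k i)%:Z - m%:Z.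
apply: qf_determined_sub (qf_determined_and (qf_determined_all det_sg) (qf_determined_and
  (qf_determined_all (fun k => qf_determined1 (def1 (expo k))))
  (qf_determined_all (fun k => qf_determined1 (defR (expo k)))))).
move=> v w [sgE [sim1 simR]].
have expoP e : (forall i, `|e i| <= m)%N -> exists k, expo k = e.
  move=> le_em; exists [ffun i => inord `|(e i + m%:Z)%R|]; apply: funext => i.
  by rewrite /expo ffunE inordK; have := le_em i; lia.
by apply: rat_sim_squares => // e /expoP[k <-].
Qed.

Lemma monomial_term L (M : structure L) (val : M -> rat) n :
  (exists t : term L n, forall v : 'I_n -> M, val (eval v t) = 1) ->
  (forall s t : term L n, exists u : term L n, forall v : 'I_n -> M,
     val (eval v u) = val (eval v s) * val (eval v t)) ->
  (forall t : term L n, exists u : term L n, forall v : 'I_n -> M,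
     val (eval v u) = (val (eval v t))^-1) ->
  forall e, exists t : term L n, forall v : 'I_n -> M,
    val (eval v t) = monomial (val \o v) e ^+ 2.
Proof.
move=> [t1 t1E] mulE invE e.
have natE (t : term L n) k : exists u : term L n, forall v : 'I_n -> M,
    val (eval v u) = val (eval v t) ^+ k.
  elim: k => [|k [u uE]]; first by exists t1.
  by have [u' u'E] := mulE t u; exists u' => v; rewrite u'E uE exprS.
suff [t tE]: exists t : term L n, forall v : 'I_n -> M, val (eval v t) = monomial (val \o v) e.
  by have [u uE] := natE t 2; exists u => v; rewrite uE tE.
rewrite /monomial; elim: (index_enum _) => [|i s [t tE]].
  by exists t1 => v; rewrite big_nil t1E.
have [u uE]: exists u : term L n, forall v : 'I_n -> M, val (eval v u) = val (v i) ^ e i.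
  case: (e i) => k; first by have [u uE] := natE (Var L i) k; exists u => v; apply: uE.
  have [u uE] := natE (Var L i) k.+1.
  by have [u' u'E] := invE u; exists u' => v; rewrite u'E uE NegzE -exprnN.
by have [u' u'E] := mulE u t; exists u' => v; rewrite big_cons u'E uE tE.
Qed.

(** * Evaluation of terms on similar tuples *)

Lemma eval_sg n (t : term q_sig n) (v w : 'I_n -> rat_structure) :
  (forall i, Num.sg (v i) = Num.sg (w i)) -> Num.sg (eval v t) = Num.sg (eval w t).
Proof.
move=> sgE; elim: t => [i|f ts IH] //=.
by case: f ts IH => //= ts IH; rewrite ?sgrM ?sgrV !IH.
Qed.

(** A term with nonzero value has no vanishing variable, as products and inverses propagate 0; so
    [abs1] is the absolute value on every variable that occurs. *)
Lemma eval_monomial n (t : term q_sig n) :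
  exists e, forall v : 'I_n -> rat_structure,
    eval v t != 0 :> rat -> `|eval v t : rat| = monomial (abs1 \o v) e.
Proof.
have abs_gt0 (v : 'I_n -> rat) : forall i, 0 < (abs1 \o v) i by move=> i; apply: abs1_gt0.
elim: t => [i|f ts IH].
  by exists (fun j => (j == i)%:Z) => v vi0; rewrite monomial_delta /= abs1E.
case: f ts IH => /= ts IH.
- by exists (fun=> 0).
- by exists (fun=> 0) => v _; rewrite monomial0 normr1.
- by exists (fun=> 0) => v _; rewrite monomial0 normrN1.
- have [e eE] := IH ord0; have [f fE] := IH ord_max.
  exists (fun i => e i + f i) => v; rewrite mulf_eq0 negb_or => /andP[/eE vE /fE wE].
  by rewrite normrM vE wE monomialD.
- have [e eE] := IH ord0; exists (fun i => -1 * e i) => v.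
  by rewrite invr_eq0 => /eE vE; rewrite normfV vE monomialZ exprN1.
Qed.

Lemma rat_sim_eq n (s t : term q_sig n) : exists2 m, (0 < m)%N &
  forall v w : 'I_n -> rat_structure, rat_sim m v w -> eval v s = eval v t -> eval w s = eval w t.
Proof.
have [e eE] := eval_monomial s; have [f fE] := eval_monomial t.
(* The sum bounds each exponent of the quotient of the two monomials; the successor makes the level
   positive. *)
exists (\sum_i `|(e i - f i)%R|).+1 => // v w [sgE [simE _]] vst.
have ws := eval_sg s sgE; have wt := eval_sg t sgE.
have [vs0|vs0] := eqVneq (eval v s) 0.
  move: ws wt; rewrite -vst vs0 sgr0 => /esym/eqP; rewrite sgr_eq0 => /eqP ->.
  by move/esym/eqP; rewrite sgr_eq0 => /eqP.
have ws0 : eval w s != 0 by rewrite -sgr_eq0 -ws sgr_eq0.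
have wt0 : eval w t != 0 by rewrite -sgr_eq0 -wt sgr_eq0 -vst.
have abs_gt0 (u : 'I_n -> rat) : forall i, 0 < (abs1 \o u) i by move=> i; apply: abs1_gt0.
have quot (u : 'I_n -> rat) : monomial (abs1 \o u) e = monomial (abs1 \o u) f <->
    monomial (abs1 \o u) (fun i => e i - f i) = 1.
  have -> : monomial (abs1 \o u) e =
      monomial (abs1 \o u) (fun i => e i - f i) * monomial (abs1 \o u) f.
    by rewrite -monomialD //; apply: eq_bigr => i _; rewrite subrK.
  have f0 : monomial (abs1 \o u) f != 0 by rewrite gt_eqF ?monomial_gt0.
  by split=> [/(canRL (mulfK f0))|->]; rewrite ?divff ?mul1r.
rewrite [eval w s]numEsg [eval w t]numEsg -ws -wt -vst; congr (_ * _).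
rewrite eE // fE //; apply/quot/simE; last by apply/quot; rewrite -eE // -fE -?vst.
by move=> i; rewrite leqW // (bigD1 i) //= leq_addr.
Qed.

Lemma rat_sim_nth_power m n (t : term q_sig n) (v w : 'I_n -> rat_structure) : (0 < m)%N ->
  rat_sim m v w -> is_nth_power m (eval v t) -> is_nth_power m (eval w t).
Proof.
move=> m0 [sgE [_ simR]] [y yE].
have ws := eval_sg t sgE; have [e eE] := eval_monomial t.
have [v0|v0] := eqVneq (eval v t) 0.
  move: ws; rewrite v0 sgr0 => /esym/eqP; rewrite sgr_eq0 => /eqP ->.
  by exists 0; rewrite expr0n gtn_eqF.
have w0 : eval w t != 0 by rewrite -sgr_eq0 -ws sgr_eq0.
have [z zE]: is_nth_power m `|eval w t|.
  by rewrite eE //; apply/simR; exists `|y|; rewrite -eE // yE normrX.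
(* The sign at w is that at v, namely [Num.sg y ^+ m]. *)
by exists (Num.sg y * z); rewrite [LHS]numEsg -ws zE yE sgrX exprMn.
Qed.

(** * Quantifier elimination for the rationals with the positivity predicate *)

Lemma sgr_eq_pos (x y : rat) : (x = 0 <-> y = 0) -> (0 < x <-> 0 < y) -> Num.sg x = Num.sg y.
Proof.
move=> xy0 xyP.
have [x_lt0|x_gt0|x0] := ltgtP x 0; last 1 first.
- by rewrite x0 (xy0.1 x0).
- rewrite (ltr0_sg x_lt0) ltr0_sg //; case: (ltgtP y 0) => // [/xyP.2|/xy0.2 x0].
    by move/(lt_trans x_lt0); rewrite ltxx.
  by rewrite x0 ltxx in x_lt0.
- by rewrite (gtr0_sg x_gt0) gtr0_sg //; apply/xyP.
Qed.

Lemma rat_QE : admits_QE (Th rat_structure).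
Proof.
refine (@back_and_forth_QE q_sig rat_structure (fun m n v w => @rat_sim m n v w) _ _ _ _ _ _).
- by move=> m n v w; apply: rat_simC.
- by move=> m k n v w; apply: rat_simM.
- move=> m n m0; have nil : 'I_0 -> term q_sig n by case.
  have [t1 t1E]: exists t : term q_sig n, forall v : 'I_n -> rat_structure, eval v t = 1.
    by exists (@App q_sig n q_one nil).
  have [t0 t0E]: exists t : term q_sig n, forall v : 'I_n -> rat_structure, eval v t = 0.
    by exists (@App q_sig n q_zero nil).
  have mon e : exists t : term q_sig n, forall v : 'I_n -> rat_structure,
      eval v t = monomial (v) e ^+ 2.
    apply: (@monomial_term q_sig rat_structure id) => [|s t|t].
    - by exists t1 => v; rewrite t1E.
    - by exists (@App q_sig n q_mul (fun i => if i == ord0 then s else t)).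
    - by exists (@App q_sig n q_inv (fun=> t)).
  apply: (@rat_sim_determined q_sig rat_structure id) => // [i|e|e].
  + have def0 : @qf_definable q_sig rat_structure n (fun v => v i = 0).
      by exists (Eq (Var q_sig i) t0) => // v /=; rewrite t0E.
    have defP : @qf_definable q_sig rat_structure n (fun v => 0 < v i :> rat).
      by exists (@Rel q_sig n q_P (fun=> Var q_sig i)).
    apply: qf_determined_sub (qf_determined_and (qf_determined1 def0) (qf_determined1 defP)).
    by move=> v w [vw0 vwP]; apply: sgr_eq_pos.
  + by have [t tE] := mon e; exists (Eq t t1) => // v /=; rewrite t1E tE.
  (* The doubled index is at least 2 even when m is 1, so the predicate exists in the signature. *)
  + have [t tE] := mon e; have m2 : (2 <= m * 2)%N by lia.
    by exists (@Rel q_sig n (q_R m2) (fun=> t)) => // v /=; rewrite tE.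
- exact: rat_sim_eq.
- move=> n [d d2|] ts /=; first by exists d; [lia | move=> v w; apply: rat_sim_nth_power; lia].
  exists 1%N => // v w [sgE _].
  by rewrite -sgr_gt0 (eval_sg (ts ord0) sgE) sgr_gt0.
- move=> m n m0; exists (2 * m * m`!)%N; first by rewrite !muln_gt0 m0 fact_gt0.
  by move=> v w vw a; have [b _] := rat_sim_extend a m0 vw; exists b.
Qed.

(** * Quantifier elimination for the nonnegative rationals *)

Fixpoint q_of_nn n (t : term nn_sig n) : term q_sig n :=
  match t with
  | Var i => Var q_sig i
  | App f ts =>
    match f return ('I_(nn_farity f) -> term q_sig n) -> term q_sig n with
    | nn_zero => @App q_sig n q_zero
    | nn_one => @App q_sig n q_one
    | nn_mul => @App q_sig n q_mul
    | nn_inv => @App q_sig n q_inv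
    end (fun i => q_of_nn (ts i))
  end.

(** Through this embedding the transfer of equations and power conditions is inherited from the
    rationals. *)
Lemma eval_q_of_nn n (t : term nn_sig n) (v : 'I_n -> nnrat_structure) :
  sval (eval v t : nnrat) = eval (M := rat_structure) (fun i => sval (v i : nnrat)) (q_of_nn t).
Proof. by elim: t => [//|f ts IH] /=; case: f ts IH => //= ts IH; rewrite !IH. Qed.

Lemma nnrat_inj : injective (fun x : nnrat => sval x).
Proof. by move=> [x x0] [y y0] /= xy; apply: val_inj. Qed.

Lemma nnrat_QE : admits_QE (Th nnrat_structure).
Proof.
pose val (x : nnrat_structure) : rat := sval (x : nnrat).
refine (@back_and_forth_QE nn_sig nnrat_structure
  (fun m n v w => @rat_sim m n (val \o v) (val \o w)) _ _ _ _ _ _).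
- by move=> m n v w; apply: rat_simC.
- by move=> m k n v w; apply: rat_simM.
- move=> m n m0; have nil : 'I_0 -> term nn_sig n by case.
  have [t1 t1E]: exists t : term nn_sig n, forall v : 'I_n -> nnrat_structure,
      eval v t = nnrat_one.
    by exists (@App nn_sig n nn_one nil).
  have [t0 t0E]: exists t : term nn_sig n, forall v : 'I_n -> nnrat_structure,
      eval v t = nnrat_zero.
    by exists (@App nn_sig n nn_zero nil).
  have mon e : exists t : term nn_sig n, forall v : 'I_n -> nnrat_structure,
      val (eval v t) = monomial (val \o v) e ^+ 2.
    apply: (@monomial_term nn_sig nnrat_structure val) => [|s t|t].
    - by exists t1 => v; rewrite t1E.
    - by exists (@App nn_sig n nn_mul (fun i => if i == ord0 then s else t)).
    - by exists (@App nn_sig n nn_inv (fun=> t)).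
  apply: (@rat_sim_determined nn_sig nnrat_structure val) => // [i|e|e].
  + have def0 : @qf_definable nn_sig nnrat_structure n (fun v => val (v i) = 0).
      exists (Eq (Var nn_sig i) t0) => // v /=; rewrite t0E.
      by split=> [->|vi0] //; apply: nnrat_inj.
    (* Without a positivity predicate, the sign of a nonnegative entry is still determined by
       whether it vanishes. *)
    apply: qf_determined_sub (qf_determined1 def0) => v w vw0.
    apply: sgr_eq_pos => //; rewrite !lt0r !(svalP (_ : nnrat)) !andbT.
    by split; apply: contra_neq => /vw0.
  + have [t tE] := mon e; exists (Eq t t1) => // v /=; rewrite t1E -tE.
    by split=> [->|t1v] //; apply: nnrat_inj.
  + have [t tE] := mon e; have m2 : (2 <= m * 2)%N by lia.
    by exists (@Rel nn_sig n (nn_R m2) (fun=> t)) => // v /=; rewrite -tE.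
- move=> n s t; have [m m0 mP] := rat_sim_eq (q_of_nn s) (q_of_nn t).
  exists m => // v w /mP vw vst; apply: nnrat_inj; rewrite /= !eval_q_of_nn.
  by apply: vw; rewrite -!eval_q_of_nn vst.
- move=> n [d d2] ts /=; exists d; first lia.
  move=> v w vw; rewrite !eval_q_of_nn; apply: rat_sim_nth_power vw; lia.
- move=> m n m0; exists (2 * m * m`!)%N; first by rewrite !muln_gt0 m0 fact_gt0.
  move=> v w vw a; have [b sgb sim_ab] := rat_sim_extend (val a) m0 vw.
  have b0 : 0 <= b by rewrite -sgr_ge0 sgb sgr_ge0; apply: (svalP (a : nnrat)).
  by exists (exist _ b b0 : nnrat); rewrite !comp_extend.
Qed.

Theorem theorem5 :
  admits_QE (Th nnrat_structure) /\ admits_QE (Th rat_structure).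
Proof. exact: conj nnrat_QE rat_QE. Qed.
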